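(* Let $(X,\mathcal{F},\mu)$ be a charge space, $(Y,\mathcal{U})$ a uniform space, and $f:X\rightarrow Y$ a $T_2$-measurable function. Let $\mathcal{S}$ be a family of uniformly continuous real-valued functions on $Y$, and let $\eta$ and $\mathcal{E}$ be the associated collections of subsets of $Y$ and of $Y\times Y$, respectively, defined in the context. 1. If $\eta$ is a subbase for the uniform topology on $Y$, then $f$ is base measurable. 2. If $\mathcal{E}$ is an entourage subbase for $\mathcal{U}$, then $f$ is uniformly base measurable.
   Context: A charge space $(X,\mathcal{F},\mu)$ is a set $X$, a field (algebra) $\mathcal{F}$ of subsets of $X$, and a positive charge $\mu:\mathcal{F}\to[0,\infty]$, i.e. a finitely additive set function with $\mu(\emptyset)=0$ (possibly $\mu(X)=\infty$). The inner charge is $\mu_*(A)=\sup\{\mu(B):B\in\mathcal{F},B\subseteq A\}$ for $A\subseteq X$. The Peano-Jordan completion $\overline{\mathcal{F}}$ is the field of all $A\subseteq X$ such that for every $\epsilon>0$ there are $B,C\in\mathcal{F}$ with $B\subseteq A\subseteq C$ and $\mu(C\setminus B)<\epsilon$. For a relation $E$ on a set and a point $y$, $E[y]=\{y':(y,y')\in E\}$. Entourages are the elements of $\mathcal{U}$; an entourage base is a subset of $\mathcal{U}$ such that each entourage contains an element of it; an entourage subbase is a subset of $\mathcal{U}$ whose finite intersections form an entourage base. $f:X\to Y$ is $T_2$-measurable if for every $\epsilon>0$ and every entourage $E$ there is a partition of $X$ into (possibly empty) sets $A_0,A_1,\ldots,A_n\in\mathcal{F}$ such that $\mu(A_0)<\epsilon$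 and $f(A_i)\times f(A_i)\subseteq E$ for each $i\in\{1,\ldots,n\}$. $f$ is base measurable if each $y\in Y$ has a neighbourhood base $\mathcal{B}_y$ (in the uniform topology; neighbourhoods need not be open) such that $f^{-1}(B)\in\overline{\mathcal{F}}$ for all $B\in\mathcal{B}_y$. $f$ is uniformly base measurable if there is an entourage base $\mathcal{B}\subseteq\mathcal{U}$ such that $f^{-1}(E[y])\in\overline{\mathcal{F}}$ for all $E\in\mathcal{B}$ and $y\in Y$. For $h:X\to\mathbb{R}$, the boundary mass limit $\phi_h:\mathbb{R}\to[0,\infty]$ is $\phi_h(z)=\lim_{\delta\to0^+}\mu_*(h^{-1}(z-\delta,z+\delta))$. Let $\Xi$ be the usual uniformity on $\mathbb{R}$. For $g:Y\to\mathbb{R}$ and $V\subseteq\mathbb{R}\times\mathbb{R}$, put $g^{-1}(V)=\{(y,y')\in Y\times Y:(g(y),g(y'))\in V\}$. For $g\in\mathcal{S}$ define $\epsilon_g=\{(-\infty,z),(z,\infty): z\in\mathbb{R},\ \phi_{g\circ f}(z)<\infty\}$ (a collection of open rays), $\eta_g=\{g^{-1}(E):E\in\epsilon_g\}$ (subsets of $Y$), $\mathcal{E}_g=\{g^{-1}(E):E\in\Xi,\ E[z]\in\epsilon_g\text{ for all }z\in\mathbb{R}\}$ (subsets of $Y\times Y$), and $\eta=\bigcup_{g\in\mathcal{S}}\eta_g$, $\mathcal{E}=\bigcup_{g\in\mathcal{S}}\mathcal{E}_g$. *)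

(* Defs.v *)
From HB Require Import structures.
From mathcomp Require Import all_boot all_order all_algebra.
From mathcomp Require Import all_classical all_reals all_analysis.

Set Implicit Arguments.
Unset Strict Implicit.
Unset Printing Implicit Defensive.

Import Order.TTheory GRing.Theory Num.Theory.
Import numFieldNormedType.Exports.

Local Open Scope classical_set_scope.
Local Open Scope ring_scope.
Local Open Scope ereal_scope.

(* Charge spaces are stated with predicates because the carriers of
   algebraOfSetsType are pointed, which would exclude the empty space.  The
   values of mu outside F are junk: no definition below depends on them.
   (The charges of mathcomp-analysis differ: they are signed and finite.) *)
Record is_charge_space (R : realType) (X : Type) (F : set (set X))
    (mu : set X -> \bar R) : Prop := IsChargeSpace {
  charge_field_setring : setring F ;
  charge_field_setT : F setT ;
  charge_set0 : mu set0 = 0 ;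
  charge_ge0 : forall A, F A -> 0 <= mu A ;
  charge_additive : forall A B, F A -> F B -> A `&` B = set0 ->
    mu (A `|` B) = mu A + mu B }.

Section charge.
Context {R : realType} {X : Type}.
Variables (F : set (set X)) (mu : set X -> \bar R).

Definition inner_charge (A : set X) : \bar R :=
  ereal_sup [set mu B | B in [set B | F B /\ B `<=` A]].

Definition peano_jordan : set (set X) :=
  [set A | forall e : R, (0 < e)%R ->
    exists B C, [/\ F B, F C, B `<=` A, A `<=` C & mu (C `\` B) < e%:E]].

Definition boundary_mass (h : X -> R) (z : R) : \bar R :=
  lim (inner_charge (h @^-1` `](z - d)%R, (z + d)%R[) @[d --> (0 : R)^'+]).

End charge.

Section measurability.
Context {R : realType} {X : Type} {Y : uniformType}.
Variables (F : set (set X)) (mu : set X -> \bar R) (f : X -> Y).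

(* The library's [partition] is not used: it requires nonempty blocks. *)
Definition T2_measurable : Prop :=
  forall (e : R) (E : set (Y * Y)), (0 < e)%R -> entourage E ->
    exists (n : nat) (A : 'I_n.+1 -> set X),
      [/\ forall i, F (A i),
          trivIset setT A,
          \bigcup_i A i = setT,
          mu (A ord0) < e%:E &
          forall i, i != ord0 -> (f @` A i) `*` (f @` A i) `<=` E].

Definition nbhs_base_at (y : Y) (B : set (set Y)) : Prop :=
  B `<=` nbhs y /\ forall U, nbhs y U -> exists2 V, B V & V `<=` U.

Definition entourage_base (B : set (set (Y * Y))) : Prop :=
  B `<=` entourage /\ forall E, entourage E -> exists2 V, B V & V `<=` E.

Definition base_measurable : Prop :=
  forall y : Y, exists2 B : set (set Y), nbhs_base_at y B &
    forall V, B V -> peano_jordan F mu (f @^-1` V).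

Definition uniformly_base_measurable : Prop :=
  exists2 B : set (set (Y * Y)), entourage_base B &
    forall E, B E -> forall y : Y, peano_jordan F mu (f @^-1` (xsection E y)).

End measurability.

(* [finI_from] includes the empty intersection, i.e. the whole space. *)
Definition topology_subbase {Y : topologicalType} (S : set (set Y)) : Prop :=
  basis (finI_from S id).

Definition entourage_subbase {Y : uniformType} (S : set (set (Y * Y))) : Prop :=
  S `<=` entourage /\ entourage_base (finI_from S id).

Section rays.
Context {R : realType} {X : Type} {Y : uniformType}.
Variables (F : set (set X)) (mu : set X -> \bar R) (f : X -> Y).

Definition finite_rays (g : Y -> R) : set (set R) :=
  [set V | (exists2 z : R, boundary_mass F mu (g \o f) z < +oo &
     (V = `]-oo, z[%classic) \/ (V = `]z, +oo[%classic))].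

Definition ray_preimages (g : Y -> R) : set (set Y) :=
  [set g @^-1` V | V in finite_rays g].

Definition ray_entourages (g : Y -> R) : set (set (Y * Y)) :=
  [set (fun p => (g p.1, g p.2)) @^-1` E | E in
     [set E : set (R * R) | entourage E /\
        (forall z : R, finite_rays g (xsection E z))]].

End rays.

(* Main.v *)
Require Import Defs.
From HB Require Import structures.
From mathcomp Require Import all_boot all_order all_algebra.
From mathcomp Require Import all_classical all_reals all_analysis.
From mathcomp Require Import lra.

Import Order.TTheory GRing.Theory Num.Theory.
Import numFieldNormedType.Exports.

Local Open Scope classical_set_scope.
Local Open Scope ring_scope.

(** A finite ray, i.e. one whose endpoint w satisfies phi_(g o f)(w) < oo,
    need not have a preimage in the Peano-Jordan completion: phi may be
    positive at w, and then the charge sitting arbitrarily close to w may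
    be impossible to split at w.  The rays can however be moved slightly.

    Finiteness of phi at w makes the inner charge of (g o f)^-1(J) finite for
    some open interval J around w.  Since the inner charge is superadditive on
    disjoint sets, one of two disjoint subintervals of J carries at most half
    of it; iterating yields nested intervals whose masses tend to 0, and their
    common point is a null point, where phi vanishes.  As this works inside
    every subinterval of J, null points accumulate at w from both sides
    ([null_at_near]).

    At a null point z the ray ending at z does have a preimage in the
    completion ([peano_jordan_null_boundary]).  A T2-partition for the
    entourage |g(y) - g(y')| < d approximates the preimage from inside by the
    blocks that it contains, and from outside by the blocks that it meets; the
    error consists of the small exceptional block and of the blocks straddling
    z, which lie over (z - d, z + d) and hence have small charge.

    Thus a finite ray containing the ball of radius d around c can be replaced
    by a smaller ray with preimage in the completion that still contains the
    ball of radius d / 2 ([shrink_finite_ray]).  That d / 2 does not depend on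
    the ray matters for the second part: the sections of an entourage can all
    be shrunk at once, and the result is still an entourage.  Since the
    completion is closed under finite intersections, shrinking each member of
    a finite intersection of subbasic sets gives the required bases. *)

(** * Finitely additive set functions and the Peano-Jordan completion *)

Section charge.
Context {R : realType} {X : Type} {F : set (set X)} {mu : set X -> \bar R}.
Context (Fmu : is_charge_space F mu).

Lemma field_set0 : F set0.
Proof. by case: (charge_field_setring Fmu). Qed.

Lemma field_setU A B : F A -> F B -> F (A `|` B).
Proof. by case: (charge_field_setring Fmu) => _ FU _; exact: FU. Qed.

Lemma field_setD A B : F A -> F B -> F (A `\` B).
Proof. by case: (charge_field_setring Fmu) => _ _ FD; exact: FD. Qed.

Lemma field_setI A B : F A -> F B -> F (A `&` B).
Proof. by move=> FA FB; rewrite -setDD; do 2?apply: field_setD. Qed.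

Lemma charge_le A B : F A -> F B -> A `<=` B -> (mu A <= mu B)%E.
Proof.
move=> FA FB AB; have FBA := field_setD B A FB FA.
rewrite -(setDUK AB) (charge_additive Fmu) ?setDIK//.
by rewrite leeDl// (charge_ge0 Fmu).
Qed.

Lemma charge_setU_le A B : F A -> F B -> (mu (A `|` B) <= mu A + mu B)%E.
Proof.
move=> FA FB; have FBA := field_setD B A FB FA.
rewrite -[A `|` B](setDUK (@subsetUl _ A B)) setDUl setDv set0U.
by rewrite (charge_additive Fmu) ?setDIK// leeD2l// charge_le.
Qed.

Lemma peano_jordan_setT : peano_jordan F mu setT.
Proof.
move=> e e0; have FT := charge_field_setT Fmu.
by exists setT, setT; split=> //; rewrite setDv (charge_set0 Fmu) lte_fin.
Qed.

Lemma peano_jordan_setI A B :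
  peano_jordan F mu A -> peano_jordan F mu B -> peano_jordan F mu (A `&` B).
Proof.
move=> pA pB e e0; have e20 : 0 < e / 2 by rewrite divr_gt0.
have [A1 [A2 [FA1 FA2 A1A AA2 mA]]] := pA _ e20.
have [B1 [B2 [FB1 FB2 B1B BB2 mB]]] := pB _ e20.
exists (A1 `&` B1), (A2 `&` B2); split.
- exact: field_setI.
- exact: field_setI.
- exact: setISS.
- exact: setISS.
have DA := field_setD _ _ FA2 FA1; have DB := field_setD _ _ FB2 FB1.
have le : A2 `&` B2 `\` A1 `&` B1 `<=` (A2 `\` A1) `|` (B2 `\` B1).
  by move=> x [[? ?]] /not_andP[?|?]; [left|right].
apply: (le_lt_trans (charge_le _ _ _ _ le)).
- by apply: field_setD; apply: field_setI.
- exact: field_setU.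
apply: (le_lt_trans (charge_setU_le _ _ DA DB)).
by rewrite (splitr e) EFinD; apply: lteD.
Qed.

Lemma charge_le_inner A B : F A -> A `<=` B -> (mu A <= inner_charge F mu B)%E.
Proof. by move=> FA AB; apply: ereal_sup_ubound; exists A. Qed.

Lemma inner_charge_le A B :
  A `<=` B -> (inner_charge F mu A <= inner_charge F mu B)%E.
Proof.
move=> AB; apply: ereal_sup_le => _ [C [FC CA] <-].
by exists C => //; split=> //; exact: subset_trans AB.
Qed.

(** * Null points *)

(** Superadditivity of the inner charge, in the form that drives the bisection
    of intervals towards a null point. *)
Lemma inner_charge_halve A B (M : R) : A `&` B = set0 ->
    (inner_charge F mu (A `|` B) <= M%:E)%E ->
  (inner_charge F mu A <= (M / 2)%:E)%E \/
  (inner_charge F mu B <= (M / 2)%:E)%E.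
Proof.
move=> AB0 ABM.
have [|lA] := leP (inner_charge F mu A) (M / 2)%:E; first by left.
have [|lB] := leP (inner_charge F mu B) (M / 2)%:E; first by right.
have [_ [A' [FA' A'A] <-] mA] := ereal_sup_gt lA.
have [_ [B' [FB' B'B] <-] mB] := ereal_sup_gt lB.
suff : (M%:E < M%:E)%E by rewrite ltxx.
rewrite {1}(splitr M) EFinD; apply: (lt_le_trans (lteD mA mB)).
rewrite -(charge_additive Fmu)//; last first.
  by rewrite -subset0 => x [/A'A ? /B'B ?]; rewrite -AB0.
apply: le_trans ABM; apply: charge_le_inner; first exact: field_setU.
exact: setUSS.
Qed.

(** The boundary mass limit of h at z is 0; spelled out with epsilons because
    the existence of the limit is then never needed. *)
Definition null_at (h : X -> R) (z : R) : Prop :=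
  forall e : R, 0 < e -> exists2 d : R, 0 < d &
    (inner_charge F mu (h @^-1` `](z - d)%R, (z + d)%R[) < e%:E)%E.

(** Bisection.  The chosen subintervals have their closures inside the previous
    interval, so that the limit point is interior to all of them. *)
Lemma null_at_exists (h : X -> R) (a b : R) : a < b ->
    (inner_charge F mu (h @^-1` `]a, b[) < +oo)%E ->
  exists2 z, a < z < b & null_at h z.
Proof.
move=> ab fin.
pose m (p : R * R) := inner_charge F mu (h @^-1` `]p.1, p.2[).
have [M abM] : exists M : R, (m (a, b) <= M%:E)%E.
  move: fin; rewrite /m /=; case: inner_charge => [r| |] // _.
    by exists r.
    by exists 0; rewrite leNye.
pose ok (p : R * R * R) := p.1.1 < p.1.2 /\ (m p.1 <= p.2%:E)%E.
have step (p : R * R * R) : exists q : R * R * R, ok p ->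
    [/\ ok q, p.1.1 < q.1.1, q.1.2 < p.1.2 & q.2 = p.2 / 2].
  have [okp|nokp] := pselect (ok p); last by exists p.
  (* The second and the fourth fifth of the interval are disjoint and stay away
     from its endpoints. *)
  case: p okp => [[c d] N] [/= cd mN]; pose t := (d - c) / 5.
  have t0 : 0 < t by rewrite /t; lra.
  have dE : d = c + 5 * t by rewrite /t; lra.
  pose l : R * R := (c + t, c + 2 * t).
  pose r : R * R := (c + 3 * t, c + 4 * t).
  have lr0 : h @^-1` `]l.1, l.2[ `&` h @^-1` `]r.1, r.2[ = set0.
    by rewrite -subset0 => x []; rewrite /= !in_itv/=; lra.
  have lrN : (inner_charge F mu
      (h @^-1` `]l.1, l.2[ `|` h @^-1` `]r.1, r.2[) <= N%:E)%E.
    apply: le_trans mN; apply: inner_charge_le => x.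
    by rewrite /= !in_itv/= dE; lra.
  have [mh|mh] := inner_charge_halve _ _ _ lr0 lrN.
    by exists (l, N / 2) => _; split=> //=; [split=> //=|..]; lra.
  by exists (r, N / 2) => _; split=> //=; [split=> //=|..]; lra.
have [s sP] := choice step.
pose u n := iter n s ((a, b), M).
have u_ok n : ok (u n).
  by elim: n => [|n IH]; [split|have [] := sP _ IH].
have lo_lt n : (u n).1.1 < (u n.+1).1.1 by have [] := sP _ (u_ok n).
have hi_lt n : (u n.+1).1.2 < (u n).1.2 by have [] := sP _ (u_ok n).
have mass n : (u n).2 = M / 2 ^+ n.
  elim: n => [|n IH]; first by rewrite expr0 divr1.
  have [_ _ _ ->] := sP _ (u_ok n).
  by rewrite IH exprSr invfM mulrA.
have lo_le n k : (n <= k)%N -> (u n).1.1 <= (u k).1.1.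
  by apply: (nondecreasing_seqP (fun i => (u i).1.1)).1 => i; exact/ltW.
have hi_le n k : (n <= k)%N -> (u k).1.2 <= (u n).1.2.
  by apply: (nonincreasing_seqP (fun i => (u i).1.2)).1 => i; exact/ltW.
have lo_hi n k : (u n).1.1 <= (u k).1.2.
  apply: (le_trans (lo_le _ _ (leq_maxl n k))).
  apply: (le_trans _ (hi_le _ _ (leq_maxr n k))).
  by have [/ltW] := u_ok (maxn n k).
pose L := range (fun n => (u n).1.1); pose z := sup L.
have supL : has_sup L.
  by split; [exists (u 0).1.1, 0|exists (u 0).1.2 => _ [n _ <-]].
have loz n : (u n).1.1 < z.
  by apply: (lt_le_trans (lo_lt n)); apply: sup_upper_bound => //; exists n.+1.
have zhi n : z < (u n).1.2.
  apply: (le_lt_trans _ (hi_lt n)); apply: ge_sup => [|_ [k _ <-]] //.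
  by case: supL.
exists z; first by rewrite (loz 0%N) (zhi 0%N).
move=> e e0.
have [n Mn] : exists n, M / 2 ^+ n < e.
  have [n Mn] : exists n : nat, M / e < n%:R.
    by exists (Num.truncn (M / e)).+1; rewrite truncnS_gt.
  exists n; rewrite ltr_pdivrMr ?exprn_gt0// mulrC -ltr_pdivrMr//.
  by apply: (lt_trans Mn); rewrite -natrX ltr_nat ltn_expl.
have := loz n; have := zhi n => zn nz.
exists (Num.min (z - (u n).1.1) ((u n).1.2 - z)).
  by rewrite lt_min; lra.
apply: (@le_lt_trans _ _ (m (u n).1)).
  apply: inner_charge_le => x; rewrite /= !in_itv/=.
  by case: (leP (z - (u n).1.1) ((u n).1.2 - z)); lra.
by have [_ /le_lt_trans->] := u_ok n; rewrite // mass lte_fin.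
Qed.

(** If every inner charge near z were infinite, so would be their limit. *)
Lemma boundary_mass_finite (h : X -> R) (z : R) :
    (boundary_mass F mu h z < +oo)%E ->
  exists2 d : R, 0 < d &
    (inner_charge F mu (h @^-1` `](z - d)%R, (z + d)%R[) < +oo)%E.
Proof.
move=> fin; apply: contrapT => none; move: fin; rewrite /boundary_mass.
rewrite (@lim_near_cst _ _ _ _ _ +oo%E) ?ltxx//.
near=> d; apply/eqP; rewrite -leye_eq leNgt; apply/negP => fin.
by apply: none; exists d.
Unshelve. all: by end_near. Qed.

(** Null points accumulate at w from both sides: w may be an endpoint of
    [a, b]. *)
Lemma null_at_near (h : X -> R) (w a b : R) :
    (boundary_mass F mu h w < +oo)%E -> a < b -> a <= w <= b ->
  exists2 z, a < z < b & null_at h z.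
Proof.
move=> /boundary_mass_finite[d d0 fin] ab awb.
have [||z zab null] :=
  @null_at_exists h (Num.max a (w - d)) (Num.min b (w + d)).
- by rewrite gt_max !lt_min; lra.
- apply: le_lt_trans fin; apply: inner_charge_le => x; rewrite /= !in_itv/=.
  by rewrite gt_max lt_min; lra.
- by exists z => //; move: zab; rewrite gt_max lt_min; lra.
Qed.

End charge.

(** * Rays with a null endpoint *)

Section measurable.
Context {R : realType} {X : Type} {Y : uniformType}.
Context {F : set (set X)} {mu : set X -> \bar R} {f : X -> Y}.
Context (Fmu : is_charge_space F mu) (f_T2 : T2_measurable F mu f).

(** The separation hypothesis says that w is the only possible boundary point of
    V, which covers open rays in both directions at once. *)
Lemma peano_jordan_null_boundary (g : Y -> R) (V : set R) (w : R) :
    unif_continuous g -> null_at (F := F) (mu := mu) (g \o f) w ->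
    (forall x y : R, V x -> ~ V y -> (x <= w <= y) \/ (y <= w <= x)) ->
  peano_jordan F mu ((g \o f) @^-1` V).
Proof.
move=> g_uc null sep e e0; have e20 : 0 < e / 2 by rewrite divr_gt0.
have [d d0 wd] := null _ e20.
have [n [A [FA _ AT A0 Ad]]] :=
  f_T2 _ _ e20 (g_uc _ (entourage_ball _ (PosNum d0))).
have F_bigcup (P : set 'I_n.+1) : F (\bigcup_(i in P) A i).
  apply: (fin_bigcup_closedP F).1 => //; split; first exact: field_set0 Fmu.
  exact: field_setU Fmu.
have osc i x y : i != ord0 -> A i x -> A i y -> `|g (f x) - g (f y)| < d.
  by move=> i0 Ax Ay; apply: (Ad i i0 (f x, f y)); split; [exists x|exists y].
pose h := g \o f.
pose inner_blocks := [set i | i != ord0 /\ A i `<=` h @^-1` V].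
pose outer_blocks := [set i | i = ord0 \/ (A i `&` h @^-1` V !=set0)].
pose straddling := [set i | [/\ i != ord0, A i `&` h @^-1` V !=set0 &
  A i `&` ~` (h @^-1` V) !=set0]].
exists (\bigcup_(i in inner_blocks) A i), (\bigcup_(i in outer_blocks) A i).
split=> //.
- by move=> x [i [_ AV] /AV].
- move=> x Vx; have [i _ Ax] : (\bigcup_i A i) x by rewrite AT.
  by exists i => //; right; exists x.
have sub : \bigcup_(i in outer_blocks) A i `\` \bigcup_(i in inner_blocks) A i
    `<=` A ord0 `|` \bigcup_(i in straddling) A i.
  move=> x [[i outi Ax] ninner]; have [i0|i0] := eqVneq i ord0.
    by left; rewrite -i0.
  right; exists i => //; split=> //.
    by case: outi => // i0'; rewrite i0' eqxx in i0.
  apply: contrapT => /nonemptyPn/disjoints_subset; rewrite setCK => AV.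
  by apply: ninner; exists i.
apply: (le_lt_trans (charge_le Fmu _ _ _ _ sub)).
- by apply: (field_setD Fmu).
- exact: (field_setU Fmu).
apply: (le_lt_trans (charge_setU_le Fmu _ _ (FA _) (F_bigcup _))).
rewrite (splitr e) EFinD; apply: lteD => //; apply: le_lt_trans wd.
apply: charge_le_inner => // x [i [i0 [y [Ay Vy]] [y' [Ay' nVy']]] Ax].
(* A block meeting both V and its complement contains, for each x in it, a
   point on the other side of w, so x is closer to w than the oscillation. *)
rewrite /= in_itv/=; have [Vx|nVx] := pselect (V (h x)).
  have := osc _ _ _ i0 Ax Ay'; have := sep _ _ Vx nVy'.
  by rewrite /h /= ltr_norml; case; lra.
have := osc _ _ _ i0 Ay Ax; have := sep _ _ Vy nVx.
by rewrite /h /= ltr_norml; case; lra.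
Qed.

(** The radius d / 2 is uniform in the ray and in c.  The endpoint w lies at
    distance at least d from c, so a null point within d / 2 of w, on the side
    of c, leaves room for the smaller ball. *)
Lemma shrink_finite_ray (g : Y -> R) (V : set R) (c d : R) :
    unif_continuous g -> finite_rays F mu f g V -> 0 < d -> ball c d `<=` V ->
  exists W : set R, [/\ ball c (d / 2) `<=` W, W `<=` V &
    peano_jordan F mu ((g \o f) @^-1` W)].
Proof.
move=> g_uc [w fin [->|->]] d0 cV.
- have cw : c < w by have := cV c (ballxx c d0); rewrite /= in_itv.
  have /negP : ~ `|c - w| < d by move=> /cV; rewrite /= in_itv/= ltxx.
  rewrite -leNgt distrC gtr0_norm ?subr_gt0// => dw.
  have [||z zw null] := null_at_near Fmu _ w (w - d / 2) w fin; [lra|lra|].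
  exists `]-oo, z[%classic; split.
  + by move=> x; rewrite /ball /= in_itv/= ltr_norml; lra.
  + by move=> x; rewrite /= !in_itv/=; lra.
  + apply: peano_jordan_null_boundary null _ => // x y; rewrite /= !in_itv/=.
    by move=> xz /negP; rewrite -leNgt => zy; left; lra.
- have wc : w < c by have := cV c (ballxx c d0); rewrite /= in_itv/= andbT.
  have /negP : ~ `|c - w| < d by move=> /cV; rewrite /= in_itv/= ltxx.
  rewrite -leNgt gtr0_norm ?subr_gt0// => dw.
  have [||z zw null] := null_at_near Fmu _ w w (w + d / 2) fin; [lra|lra|].
  exists `]z, +oo[%classic; split.
  + by move=> x; rewrite /ball /= in_itv/= ltr_norml; lra.
  + by move=> x; rewrite /= !in_itv/= !andbT; lra.
  + apply: peano_jordan_null_boundary null _ => // x y.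
    rewrite /= !in_itv/= !andbT => xz /negP; rewrite -leNgt => zy.
    by right; lra.
Qed.

End measurable.

(** * Bases from subbases *)

(** The neighbourhoods of y with preimage in the completion generate a filter,
    so it suffices that each subbasic set around y contains one of them. *)
Lemma subbase_base_measurable (R : realType) (X : Type) (F : set (set X))
    (mu : set X -> \bar R) (Y : uniformType) (f : X -> Y) (S : set (Y -> R)) :
    is_charge_space F mu -> T2_measurable F mu f ->
    (forall g, S g -> unif_continuous g) ->
    topology_subbase (\bigcup_(g in S) ray_preimages F mu f g) ->
  base_measurable F mu f.
Proof.
move=> Fmu f_T2 S_uc [_ base] y.
pose good := [set V : set Y | nbhs y V /\ peano_jordan F mu (f @^-1` V)].
have goodF : Filter (filter_from good id).
  apply: filter_from_filter.
    exists setT; split; first exact: filterT.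
    by rewrite preimage_setT; exact: peano_jordan_setT Fmu.
  move=> V W [nV pV] [nW pW]; exists (V `&` W) => //; split.
    exact: filterI.
  by rewrite preimage_setI; exact: (peano_jordan_setI Fmu).
exists good; first split; first by move=> V [].
  move=> U /(base y)[_ [[D DS <-] Dy] DU].
  apply: (@filterS _ (filter_from good id) _ _ _ DU).
  apply: (@filter_bigI _ _ _ id) => V DV.
  have [g Sg [B Bray gB]] := set_mem (DS _ DV).
  have [d /= d0 dB] : nbhs_ball (g y) B.
    apply/nbhs_ballP; apply: open_nbhs_nbhs; split.
      by case: Bray => w _ [->|->]; [exact: lray_open|exact: rray_open].
    by have := Dy _ DV; rewrite -gB.
  have [W [dW WB pW]] :=
    shrink_finite_ray Fmu f_T2 _ _ _ _ (S_uc _ Sg) Bray d0 dB.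
  exists (g @^-1` W); last by rewrite -gB; exact: preimage_subset.
  split=> //; rewrite -nbhs_entourageE.
  have d20 : 0 < d / 2 by rewrite divr_gt0.
  exists [set p | ball (g p.1) (d / 2) (g p.2)].
    exact: (S_uc _ Sg _ (entourage_ball _ (PosNum d20))).
  by move=> y' /xsectionP; exact: dW.
by move=> V [].
Qed.

(** The same filter argument for entourages; here every section of an entourage
    is shrunk separately, by choice, with a common radius d / 2. *)
Lemma subbase_uniformly_base_measurable (R : realType) (X : Type)
    (F : set (set X)) (mu : set X -> \bar R) (Y : uniformType) (f : X -> Y)
    (S : set (Y -> R)) :
    is_charge_space F mu -> T2_measurable F mu f ->
    (forall g, S g -> unif_continuous g) ->
    entourage_subbase (\bigcup_(g in S) ray_entourages F mu f g) ->
  uniformly_base_measurable F mu f.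
Proof.
move=> Fmu f_T2 S_uc [_ [_ base]].
pose good := [set E : set (Y * Y) | entourage E /\
  forall y, peano_jordan F mu (f @^-1` xsection E y)].
have goodF : Filter (filter_from good id).
  apply: filter_from_filter.
    exists setT; split=> [|y]; first exact: filterT.
    by rewrite xsectionE !preimage_setT; exact: peano_jordan_setT Fmu.
  move=> V W [nV pV] [nW pW]; exists (V `&` W) => //; split=> [|y].
    exact: filterI.
  by rewrite xsectionI preimage_setI; exact: (peano_jordan_setI Fmu).
exists good; first split; first by move=> V [].
  move=> U /base[_ [D DS <-] DU].
  apply: (@filterS _ (filter_from good id) _ _ _ DU).
  apply: (@filter_bigI _ _ _ id) => V DV.
  have [g Sg [E [entE rayE] gE]] := set_mem (DS _ DV).
  move: entE; rewrite -entourage_ballE => -[d /= d0 dE].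
  have shrink z : exists W : set R, [/\ ball z (d / 2) `<=` W,
      W `<=` xsection E z & peano_jordan F mu ((g \o f) @^-1` W)].
    apply: shrink_finite_ray => //; first exact: S_uc.
    by move=> x zx; apply/xsectionP; exact: dE.
  have [W WP] := choice shrink.
  exists [set p : Y * Y | W (g p.1) (g p.2)].
    split=> [|y].
      apply: (S_uc _ Sg [set p | W p.1 p.2]).
      rewrite -entourage_ballE; exists (d / 2) => /=; first exact: divr_gt0.
      by move=> [z x] /= zx; have [+ _ _] := WP z; exact.
    by rewrite xsectionE; have [_ _] := WP (g y).
  move=> [y y'] /= Wy; rewrite -gE /=.
  by have [_ + _] := WP (g y); move=> /(_ _ Wy)/xsectionP.
by move=> V [].
Qed.

Theorem theorem2p5 (R : realType) (X : Type) (F : set (set X))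
    (mu : set X -> \bar R) (Y : uniformType) (f : X -> Y) (S : set (Y -> R))
    (Fmu : is_charge_space F mu)
    (f_T2 : T2_measurable F mu f)
    (S_uc : forall g, S g -> unif_continuous g) :
  (topology_subbase (\bigcup_(g in S) ray_preimages F mu f g) ->
     base_measurable F mu f) /\
  (entourage_subbase (\bigcup_(g in S) ray_entourages F mu f g) ->
     uniformly_base_measurable F mu f).
Proof.
split; first exact: subbase_base_measurable.
exact: subbase_uniformly_base_measurable.
Qed.
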